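(* Let $\mathfrak{n}>\mathfrak{m}\ge2$ be integers. For all (nonempty) subshifts $\Sigma\subset\Delta_{\mathfrak{m},\mathfrak{n}}^{\mathbb{N}}$, $$\max\left\{\frac{h(\pi\Sigma)}{\log\mathfrak{m}},\frac{h(\Sigma)}{\log\mathfrak{n}}\right\}\le\dim_{\mathrm{H}}\Pi(\Sigma)\le\underline{\dim}_{\mathrm{B}}\Pi(\Sigma)\le\overline{\dim}_{\mathrm{B}}\Pi(\Sigma)\le\frac{h(\pi\Sigma)}{\log\mathfrak{m}}+\frac{h(\Sigma)-h(\pi\Sigma)}{\log\mathfrak{n}}.$$
   Context: Let $\mathfrak{n}>\mathfrak{m}\ge2$ be integers and $\Delta_{\mathfrak{m},\mathfrak{n}}=\{(a,b): 1\le a\le\mathfrak{m},\ 1\le b\le\mathfrak{n},\ a,b\in\mathbb{N}\}$. For $(a,b)\in\Delta_{\mathfrak{m},\mathfrak{n}}$ let $S_{(a,b)}:[0,1]^2\to[0,1]^2$, $S_{(a,b)}(x,y)=\left(\frac{x+a-1}{\mathfrak{m}},\frac{y+b-1}{\mathfrak{n}}\right)$. The coding map $\Pi:\Delta_{\mathfrak{m},\mathfrak{n}}^{\mathbb{N}}\to[0,1]^2$ is $\Pi((a_1,b_1)(a_2,b_2)\ldots)=\lim_{n\to\infty}S_{(a_1,b_1)}\circ\cdots\circ S_{(a_n,b_n)}(0)$. A subshift is a compact set $\Sigma$ of sequences over a finite alphabet with $\sigma(\Sigma)\subseteq\Sigma$, where $\sigma$ is the left shift. $\Sigma_n$ denotes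 the set of words of length $n$ appearing in sequences of $\Sigma$, and the topological entropy is $h(\Sigma)=\lim_{n\to\infty}\frac1n\log\#\Sigma_n$. The projection $\pi$ is $\pi((a_1,b_1)(a_2,b_2)\ldots)=a_1a_2\ldots$; $\pi\Sigma$ is again a subshift. $\dim_{\mathrm{H}}$ is Hausdorff dimension. For bounded $E$, $N_\delta(E)$ is the smallest number of sets of diameter $\delta$ needed to cover $E$; the lower and upper box dimensions $\underline{\dim}_{\mathrm{B}}E$ and $\overline{\dim}_{\mathrm{B}}E$ are the lower and upper limits as $\delta\to0$ of $\log N_\delta(E)/(-\log\delta)$. *)

(* Defs.v *)
From HB Require Import structures.
From mathcomp Require Import all_boot all_order all_algebra.
From mathcomp Require Import all_classical all_reals all_analysis.

Set Implicit Arguments.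
Unset Strict Implicit.
Unset Printing Implicit Defensive.

Import Order.TTheory GRing.Theory Num.Theory.
Import numFieldNormedType.Exports.

Local Open Scope classical_set_scope.
Local Open Scope ring_scope.

(** Symbolic dynamics over a finite alphabet *)

Definition shift (A : Type) (x : nat -> A) : nat -> A := fun k => x k.+1.

(* Compactness is for the product topology on A^nat, with A discrete. *)
Definition subshift (A : finType) (Sigma : set (nat -> A)) : Prop :=
  compact (Sigma : set {ptws nat -> discrete_topology A}) /\
  @shift A @` Sigma `<=` Sigma.

Definition appears (A : finType) (Sigma : set (nat -> A)) (n : nat)
    (w : n.-tuple A) : Prop :=
  exists2 x, Sigma x & exists k, forall i : 'I_n, tnth w i = x (k + i)%N.

Definition words (A : finType) (Sigma : set (nat -> A)) (n : nat) :
    {set n.-tuple A} :=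
  finset (fun w => `[< appears Sigma w >]).

(* [lim] has a junk value on divergent sequences; this sequence converges for
   every nonempty subshift, because #|words Sigma n| is submultiplicative. *)
Definition entropy (R : realType) (A : finType) (Sigma : set (nat -> A)) : R :=
  lim ((fun n : nat => ln (#|words Sigma n|%:R : R) / n%:R) @ \oo).

(** Digits and coding map *)

(* Digits are numbered from 0: (i, j) stands for the pair (a, b) = (i+1, j+1)
   with 1 <= a <= m and 1 <= b <= n. *)
Definition digit (m n : nat) : finType := ('I_m * 'I_n)%type.

(* i and j below are the numbers a - 1 and b - 1 *)
Definition S_map (R : realType) (m n : nat) (d : digit m n) (p : R * R) :
    R * R :=
  ((p.1 + d.1%:R) / m%:R, (p.2 + d.2%:R) / n%:R).

(* Joins the pointed and topological structures of a product, needed by [lim] *)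
HB.instance Definition _ (T U : ptopologicalType) := Pointed.on (T * U)%type.

(* foldr f p [:: d_1; ...; d_k] is f d_1 (... (f d_k p)) *)
Definition coding (R : realType) (m n : nat) (x : nat -> digit m n) : R * R :=
  lim ((fun k : nat => foldr (@S_map R m n) (0, 0) (mkseq x k)) @ \oo).

Definition proj_seq (m n : nat) (x : nat -> digit m n) : nat -> 'I_m :=
  fun k => (x k).1.

(** Dimensions of subsets of the Euclidean plane *)

(* The library norm on R * R is the sup norm, hence the explicit distance. *)
Definition edist (R : realType) (p q : R * R) : R :=
  Num.sqrt ((p.1 - q.1) ^+ 2 + (p.2 - q.2) ^+ 2).

(* The maximum with 0 only matters for the empty set, whose diameter is 0. *)
Definition diam (R : realType) (U : set (R * R)) : \bar R :=
  maxe 0%E (ereal_sup [set (edist p q)%:E | p in U & q in U]).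

(* The empty set contributes 0 to Hausdorff sums, also when s = 0. *)
Definition diam_pow (R : realType) (s : R) (U : set (R * R)) : \bar R :=
  if `[< U = set0 >] then 0%E else poweR (diam U) s.

Definition hausdorff_pre (R : realType) (s delta : R) (E : set (R * R)) :
    \bar R :=
  ereal_inf [set (\sum_(0 <= i <oo) diam_pow s (U i))%E |
    U in [set U : nat -> set (R * R) |
           E `<=` \bigcup_i U i /\ forall i, (diam (U i) <= delta%:E)%E]].

(* hausdorff_pre is nonincreasing in delta: its limit at 0 is a supremum. *)
Definition hausdorff_measure (R : realType) (s : R) (E : set (R * R)) :
    \bar R :=
  ereal_sup [set hausdorff_pre s delta E | delta in [set delta | 0 < delta]].

Definition hausdorff_dim (R : realType) (E : set (R * R)) : \bar R :=
  ereal_inf [set s%:E | s in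
    [set s : R | 0 <= s /\ hausdorff_measure s E = 0%E]].

(* Equal to +oo if no finite cover exists *)
Definition covering_number (R : realType) (delta : R) (E : set (R * R)) :
    \bar R :=
  ereal_inf [set (k%:R)%:E | k in
    [set k : nat | exists U : 'I_k -> set (R * R),
      E `<=` \bigcup_i U i /\ forall i, diam (U i) = delta%:E]].

Definition box_ratio (R : realType) (E : set (R * R)) (delta : R) : \bar R :=
  (lne (covering_number delta E) / (- ln delta)%:E)%E.

Definition lower_box_dim (R : realType) (E : set (R * R)) : \bar R :=
  limf_einf (box_ratio E) 0^'+.

Definition upper_box_dim (R : realType) (E : set (R * R)) : \bar R :=
  limf_esup (box_ratio E) 0^'+.

(* Main.v *)
Require Import Defs.
From mathcomp Require Import all_boot all_order all_algebra.
From mathcomp Require Import all_classical all_reals all_analysis.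
From mathcomp Require Import lra.

Set Implicit Arguments.
Unset Strict Implicit.
Unset Printing Implicit Defensive.

Import Order.TTheory GRing.Theory Num.Theory.
Import numFieldNormedType.Exports.

Local Open Scope classical_set_scope.
Local Open Scope ring_scope.

(** Why the chain of inequalities holds.

    Lower bound.  A set of diameter at most m^-l only meets the codings of
    boundedly many words of length l over the first digits, and a set of
    diameter at most n^-l only those of boundedly many words of length l over
    the full alphabet.  So if the s-dimensional Hausdorff measure of E vanishes,
    an efficient cover of E turns into a cover of the subshift by cylinders
    [w] with sum of b^(-s |w|) at most 1, where b is m or n; by compactness
    finitely many cylinders suffice.  Furstenberg's argument then bounds the
    entropy by s ln b: every sequence starts with a word w of the cover and
    continues with a sequence of the subshift, hence
      #words N <= sum over w of #words (N - |w|),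
    and induction on N gives #words N <= K b^(s N).  The lemmas are
    [words_prefix_cover], [furstenberg_bound] and [hausdorff_dim_ge], which is
    applied to both alphabets.

    Middle.  A cover by fewer than delta^-c sets of diameter delta has
    s-dimensional sum less than delta^(s - c), which tends to 0 with delta when
    c < s; see [hausdorff_measure0].

    Upper bound.  E is covered by approximate squares.  Given delta, take l with
    n^-l about delta and the least L with m^L >= n^l.  A point of E is known up
    to about delta in both coordinates from the first l digits of its code and
    the next L - l first digits, so
      N_delta(E) <= #words l * #(projected words) (L - l).
    Since L is about l ln n / ln m, taking logarithms gives the bound; see
    [covering_number_coding_le] and [ln_covering_le].

    Entropies are limits by Fekete's lemma on subadditive sequences, which also
    supplies the uniform bound ln #words k <= (h + e) k + C. *)

(** * Finite covers of subshifts *)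

Definition finitely_determined (A : Type) (O : set (nat -> A)) : Prop :=
  exists k, forall x y, (forall i, (i < k)%N -> x i = y i) -> O x -> O y.

(** Compactness for the product of discrete topologies, in the only form that
    the covering argument uses.  Unlike an open cover, a cover by finitely
    determined sets pulls back at once along a letter-to-letter map. *)
Definition cylinder_compact (A : Type) (Gamma : set (nat -> A)) : Prop :=
  forall O : nat -> set (nat -> A), (forall i, finitely_determined (O i)) ->
    Gamma `<=` \bigcup_i O i ->
    exists N, forall x, Gamma x -> exists2 i, (i < N)%N & O i x.

Lemma nbhs_prefix (A : finType) (x : {ptws nat -> discrete_topology A}) k :
  nbhs x [set y | forall j, (j < k)%N -> x j = y j].
Proof.
elim: k => [|k IHk].
  by apply: (@filterS _ _ (nbhs_filter x) setT) => //; exact: (@filterT _ _ (nbhs_filter x)).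
have near_k : nbhs x [set y : {ptws nat -> discrete_topology A} | x k = y k].
  apply: (@proj_continuous nat (fun=> discrete_topology A) k x [set a | x k = a]).
  by rewrite /nbhs/= /principal_filter/= => _ ->.
apply: (@filterS2 _ _ (nbhs_filter x) _ _ _ _ IHk near_k) => y IHy yk j.
by rewrite ltnS leq_eqVlt => /predU1P[->//|]; exact: IHy.
Qed.

(** A finitely determined set is open, and the unions of O 0, ..., O (N - 1) grow
    with N, so near-covering compactness along the filter of large N applies. *)
Lemma compact_cylinder_compact (A : finType) (Sigma : set (nat -> A)) :
  compact (Sigma : set {ptws nat -> discrete_topology A}) ->
  cylinder_compact Sigma.
Proof.
move=> /compact_near_coveringP cS O detO SO.
have [] := cS nat \oo (fun N x => exists2 i, (i < N)%N & O i x) _.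
  move=> x Sx; have [i _ Oix] := SO x Sx; have [k Ok] := detO i.
  exists ([set y : nat -> A | forall j, (j < k)%N -> x j = y j], [set N | (i < N)%N]).
    split=> /=; first exact: nbhs_prefix.
    by exists i.+1 => // N; exact.
  case=> /= y N [yx iN]; exists i => //; exact: Ok yx Oix.
move=> N _ HN; exists N => x Sx; exact: (HN N (leqnn N) x Sx).
Qed.

Lemma cylinder_compact_image (A B : Type) (g : A -> B) (Gamma : set (nat -> A)) :
  cylinder_compact Gamma -> cylinder_compact ((fun x => g \o x) @` Gamma).
Proof.
move=> cG O detO GO.
have [] := cG (fun i => [set x | O i (g \o x)]).
- move=> i; have [k Ok] := detO i; exists k => x y xy /=; apply: Ok => j jk /=.
  by rewrite xy.
- by move=> x Gx; have [|i _ ?] := GO (g \o x); [exists x|exists i].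
- by move=> N HN; exists N => _ [x Gx <-]; exact: HN.
Qed.

(** * Counting words *)

Lemma eq_mkseqP (A : Type) (x y : nat -> A) k :
  mkseq x k = mkseq y k <-> forall i, (i < k)%N -> x i = y i.
Proof.
split=> [E i ik|xy].
  by have := congr1 (fun s => nth (x 0%N) s i) E; rewrite /= !nth_mkseq.
by rewrite /mkseq -!val_enum_ord -!map_comp; apply: eq_map => i /=; exact: xy.
Qed.

Lemma mkseqD (A : Type) (x : nat -> A) p q :
  mkseq x (p + q) = mkseq x p ++ mkseq (fun i => x (p + i)%N) q.
Proof.
by rewrite /mkseq iotaD map_cat add0n -{2}[p]addn0 iotaDl -map_comp.
Qed.

Definition initial_word (A : Type) (x : nat -> A) n : n.-tuple A :=
  [tuple of map x (iota 0 n)].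

Section words.
Variables (A : finType) (Gamma : set (nat -> A)).
Hypothesis shiftG : @Defs.shift A @` Gamma `<=` Gamma.

Lemma shift_iter x k : Gamma x -> Gamma (fun i => x (k + i)%N).
Proof.
elim: k => [|k IHk] Gx; first by have -> : (fun i => x (0 + i)%N) = x by [].
have -> : (fun i => x (k.+1 + i)%N) = Defs.shift (fun i => x (k + i)%N).
  by apply/funext => i; rewrite /Defs.shift addnS addSn.
by apply: shiftG; exists (fun i => x (k + i)%N) => //; exact: IHk.
Qed.

(** Shift invariance makes words at any position occur as initial words. *)
Lemma wordsP n (w : n.-tuple A) :
  reflect (exists2 x, Gamma x & val w = mkseq x n) (w \in words Gamma n).
Proof.
rewrite inE; apply: (iffP (asboolP _)) => [[x Gx [k wx]]|[x Gx wx]].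
  exists (fun i => x (k + i)%N); first exact: shift_iter.
  have <- : mkseq (fun i => x (k + i)%N) (size w) = mkseq (fun i => x (k + i)%N) n.
    by rewrite size_tuple.
  have a0 : A := x 0%N.
  apply: (@eq_from_nth _ a0) => [|i]; first by rewrite size_mkseq.
  rewrite size_tuple => ilt.
  by rewrite nth_mkseq ?size_tuple// -(wx (Ordinal ilt)) (tnth_nth a0).
exists x => //; exists 0%N => i; rewrite (tnth_nth (x 0%N)) wx nth_mkseq//.
Qed.

Lemma mem_words x n : Gamma x -> initial_word x n \in words Gamma n.
Proof. by move=> Gx; apply/wordsP; exists x. Qed.

Lemma words_gt0 n : Gamma !=set0 -> (0 < #|words Gamma n|)%N.
Proof. by move=> [x Gx]; apply/card_gt0P; exists (initial_word x n); exact: mem_words. Qed.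

(* Words as plain sequences, so that words of different lengths can be
   concatenated without casts. *)
Let wseq n := [seq val w | w <- enum (words Gamma n)].

Let size_wseq n : size (wseq n) = #|words Gamma n|.
Proof. by rewrite size_map cardE. Qed.

Let uniq_wseq n : uniq (wseq n).
Proof. by rewrite map_inj_uniq ?enum_uniq//; exact: val_inj. Qed.

Let mem_wseq n s : s \in wseq n -> exists2 x, Gamma x & s = mkseq x n.
Proof. by move=> /mapP[w]; rewrite mem_enum => /wordsP[x Gx wx ->]; exists x. Qed.

Let wseq_mem n x : Gamma x -> mkseq x n \in wseq n.
Proof.
by move=> Gx; apply/mapP; exists (initial_word x n) => //; rewrite mem_enum mem_words.
Qed.

Lemma words_submul p q :
  (#|words Gamma (p + q)| <= #|words Gamma p| * #|words Gamma q|)%N.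
Proof.
rewrite -!size_wseq -(size_allpairs cat); apply: uniq_leq_size => // s.
move=> /mem_wseq[x Gx ->]; rewrite mkseqD; apply: allpairs_f; apply: wseq_mem => //.
exact: shift_iter.
Qed.

(** Cut an initial word of length N after its prefix in W: the rest is again an
    initial word of a sequence of Gamma, by shift invariance. *)
Lemma words_prefix_cover (W : seq (seq A)) N :
  (forall x, Gamma x -> exists2 w, w \in W & mkseq x (size w) = w) ->
  (forall w, w \in W -> size w <= N)%N ->
  (#|words Gamma N| <= \sum_(w <- W) #|words Gamma (N - size w)|)%N.
Proof.
move=> WG WN; pose l := flatten [seq [seq w ++ v | v <- wseq (N - size w)] | w <- W].
have -> : (\sum_(w <- W) #|words Gamma (N - size w)|)%N = size l.
  rewrite size_flatten /shape -map_comp sumnE big_map; apply: eq_bigr => w _ /=.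
  by rewrite size_map size_wseq.
rewrite -size_wseq; apply: uniq_leq_size => // s /mem_wseq[x Gx ->].
have [w Ww xw] := WG x Gx; apply/flattenP => /=.
exists [seq w ++ v | v <- wseq (N - size w)]; first exact: map_f.
rewrite -(subnKC (WN w Ww)) mkseqD xw subnKC ?WN//; apply: map_f.
by apply: wseq_mem; exact: shift_iter.
Qed.

(** The recursion of [words_prefix_cover] has the supersolution K t^-N because
    the weights t^|w| sum to at most 1; K absorbs the lengths N that are too
    short for the recursion. *)
Lemma furstenberg_bound (R : realFieldType) (t : R) (W : seq (seq A)) :
  0 < t ->
  (forall x, Gamma x -> exists2 w, w \in W & mkseq x (size w) = w) ->
  (forall w, w \in W -> 0 < size w)%N ->
  \sum_(w <- W) t ^+ size w <= 1 ->
  exists2 K : R, 0 < K & forall N, #|words Gamma N|%:R * t ^+ N <= K.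
Proof.
move=> t0 WG W0 W1; pose a N : R := #|words Gamma N|%:R.
have a0 N : 0 <= a N * t ^+ N by rewrite mulr_ge0// exprn_ge0// ltW.
pose L := (\max_(w <- W) size w)%N.
have WL w : w \in W -> (size w <= L)%N by move=> Ww; rewrite /L leq_bigmax_seq.
pose K := 1 + \sum_(i < L) a i * t ^+ i.
have K0 : 0 < K by rewrite ltr_pwDl// sumr_ge0.
exists K => // N; rewrite -/(a N); elim/ltn_ind: N => N IHN.
have [NL|LN] := ltnP N L.
  rewrite /K (bigD1 (Ordinal NL))//= addrCA lerDl addr_ge0// sumr_ge0//.
have WN w : w \in W -> (size w <= N)%N by move=> /WL/leq_trans; exact.
apply: (@le_trans _ _ (\sum_(w <- W) t ^+ size w * K)); last first.
  by rewrite -mulr_suml ler_piMl// ltW.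
apply: (@le_trans _ _ (\sum_(w <- W) a (N - size w)%N * t ^+ N)).
  rewrite -mulr_suml ler_wpM2r ?exprn_ge0 ?(ltW t0)// /a -natr_sum ler_nat.
  exact: words_prefix_cover.
rewrite big_seq [leRHS]big_seq ler_sum// => w Ww.
rewrite -{2}(subnK (WN w Ww)) exprD mulrA mulrC ler_pM2l ?exprn_gt0//.
by apply: IHN; rewrite ltn_subrL (leq_trans (W0 w Ww) (WN w Ww)) W0.
Qed.

End words.

(** * Entropy *)

(** Fekete's lemma.  The limit is the infimum of the u p / p; dividing k by a
    nearly optimal p gives the upper bound, whose error C, the sum of the values
    of u at the possible remainders, does not depend on k. *)
Lemma fekete (R : realType) (u : nat -> R) :
  (forall k, 0 <= u k) -> (forall p q, u (p + q)%N <= u p + u q) ->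
  exists h : R, [/\ 0 <= h, u k / k%:R @[k --> \oo] --> h &
    forall e, 0 < e -> exists2 C, 0 <= C & forall k, u k <= (h + e) * k%:R + C].
Proof.
move=> u0 uD; pose S := [set u p.+1 / p.+1%:R | p in [set: nat]].
have S0 : S !=set0 by exists (u 1%N / 1%:R); exists 0%N.
have lbS : lbound S 0 by move=> _ [p _ <-]; rewrite divr_ge0.
have hS : has_inf S by split => //; exists 0.
pose h := inf S; have h0 : 0 <= h by exact: lb_le_inf.
have hle k : h <= u k.+1 / k.+1%:R by apply: ge_inf; [exists 0|exists k].
have uM p q r : u (q * p + r)%N <= q%:R * u p + u r.
  elim: q => [|q IHq]; first by rewrite mul0n mul0r !add0r.
  rewrite mulSn -addnA (le_trans (uD _ _))// -natr1 mulrDl mul1r [_ + u p]addrC.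
  by rewrite -addrA lerD2l.
have Ch e : 0 < e -> exists2 C, 0 <= C & forall k, u k <= (h + e) * k%:R + C.
  move=> e0; have [_ [p _ <-]] := inf_adherent e0 hS; rewrite -/h => up.
  exists (\sum_(i < p.+1) u i); first exact: sumr_ge0.
  move=> k; rewrite {1}(divn_eq k p.+1) (le_trans (uM _ _ _))//.
  have kp : (k %% p.+1 < p.+1)%N by rewrite ltn_mod.
  rewrite lerD//; last by rewrite (bigD1 (Ordinal kp))//= lerDl sumr_ge0.
  apply: (@le_trans _ _ ((k %/ p.+1 * p.+1)%N%:R * (h + e))).
    rewrite natrM -mulrA ler_wpM2l// mulrC -ler_pdivrMr//; exact: ltW.
  by rewrite mulrC ler_wpM2l ?ler_nat ?leq_divM// addr_ge0// ltW.
exists h; split => //.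
apply/cvgrPdist_le => e e0.
have [|C C0 uC] := Ch (e / 2); first by rewrite divr_gt0.
near=> k.
have k0 : (0 < k)%N by near: k; exact: nbhs_infty_gt.
have kC : C / (e / 2) <= k%:R by near: k; exact: nbhs_infty_ger.
have kR : 0 < k%:R :> R by rewrite ltr0n.
have uk : u k / k%:R <= h + e.
  rewrite ler_pdivrMr// (le_trans (uC k))//.
  have : C <= e / 2 * k%:R by rewrite mulrC -ler_pdivrMr ?divr_gt0.
  lra.
have := hle k.-1; rewrite prednK// => hk.
by rewrite ler_norml; apply/andP; split; lra.
Unshelve. all: by end_near. Qed.

(** Subadditivity shows that the limit defining the entropy exists, so that its
    value is meaningful. *)
Lemma entropyP (R : realType) (A : finType) (Gamma : set (nat -> A)) :
  @Defs.shift A @` Gamma `<=` Gamma -> Gamma !=set0 ->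
  let u k : R := ln #|words Gamma k|%:R in
  let h : R := entropy R Gamma in
  [/\ 0 <= h, u k / k%:R @[k --> \oo] --> h &
    forall e, 0 < e -> exists2 C, 0 <= C & forall k, u k <= (h + e) * k%:R + C].
Proof.
move=> sG G0 u h.
have card0 k : (0 < #|words Gamma k|)%N by exact: words_gt0.
have [k|p q|l [l0 ul Cl]] := @fekete R u.
- by rewrite ln_ge0// ler1n.
- rewrite -lnM ?posrE ?ltr0n// ler_ln ?posrE ?mulr_gt0 ?ltr0n//.
  by rewrite -natrM ler_nat words_submul.
- by have -> : h = l by exact/cvg_lim.
Qed.

Lemma entropy_le (R : realType) (A : finType) (Gamma : set (nat -> A)) (t K : R) :
  @Defs.shift A @` Gamma `<=` Gamma -> Gamma !=set0 -> 0 < t -> 0 < K ->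
  (forall N, #|words Gamma N|%:R * t ^+ N <= K) -> entropy R Gamma <= - ln t.
Proof.
move=> sG G0 t0 K0 aK; have [_ ul _] := entropyP R sG G0.
set h := entropy R Gamma in ul *.
have vl : - ln t + ln K / k%:R @[k --> \oo] --> - ln t.
  rewrite -[X in _ --> X]addr0; apply: cvgD; first exact: cvg_cst.
  rewrite -(mulr0 (ln K)); apply: cvgMr.
  apply/gtr0_cvgV0; last exact: cvgr_idn.
  by near=> k; rewrite ltr0n; near: k; exact: nbhs_infty_gt.
apply: (ler_cvg_to ul vl); near=> k.
have kR : 0 < k%:R :> R by rewrite ltr0n; near: k; exact: nbhs_infty_gt.
have c0 : 0 < #|words Gamma k|%:R :> R by rewrite ltr0n words_gt0.
rewrite ler_pdivrMr// mulrDl divfK ?gt_eqF//.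
have := aK k; rewrite -ler_ln ?posrE ?mulr_gt0 ?exprn_gt0//.
rewrite lnM ?posrE ?exprn_gt0// lnXn// -mulr_natr; lra.
Unshelve. all: by end_near. Qed.

(** * Digit expansions and the coding map *)

Fixpoint numeral (b : nat) (a : nat -> nat) (k : nat) : nat :=
  if k is k'.+1 then (numeral b a k' * b + a k')%N else 0%N.

Lemma eq_numeral b a a' k :
  (forall i, (i < k)%N -> a i = a' i) -> numeral b a k = numeral b a' k.
Proof.
elim: k => //= k IHk aa'; rewrite IHk ?aa'// => i ik; apply: aa'; exact: ltnW.
Qed.

Lemma numeral_inj b a a' k : (forall i, a i < b)%N -> (forall i, a' i < b)%N ->
  numeral b a k = numeral b a' k -> forall i, (i < k)%N -> a i = a' i.
Proof.
move=> ab a'b; elim: k => //= k IHk E i; rewrite ltnS leq_eqVlt.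
have b0 : (0 < b)%N by exact: leq_ltn_trans (ab 0%N).
have ak : a k = a' k.
  by have := congr1 (modn^~ b) E; rewrite /= !modnMDl !modn_small.
move=> /predU1P[->//|]; apply: IHk; move: E => /eqP.
by rewrite ak eqn_add2r eqn_pmul2r// => /eqP.
Qed.

Lemma foldr_S_map (R : realType) (m n : nat) (x : nat -> digit m n) (k : nat) p :
  foldr (@S_map R m n) p (mkseq x k) =
    (((numeral m (fun i => (x i).1) k)%:R + p.1) / m%:R ^+ k,
     ((numeral n (fun i => (x i).2) k)%:R + p.2) / n%:R ^+ k).
Proof.
have m0 : m%:R != 0 :> R.
  by rewrite pnatr_eq0 -lt0n (leq_ltn_trans _ (ltn_ord (x 0%N).1)).
have n0 : n%:R != 0 :> R.
  by rewrite pnatr_eq0 -lt0n (leq_ltn_trans _ (ltn_ord (x 0%N).2)).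
elim: k p => [|k IHk] p; first by rewrite /= !expr0 !add0r !divr1 -surjective_pairing.
rewrite mkseqS foldr_rcons IHk /= !natrD !natrM.
have E (b : R) (N q c : R) : b != 0 ->
    (N + (q + c) / b) / b ^+ k = (N * b + c + q) / b ^+ k.+1.
  move=> b0; rewrite exprS invfM mulrA; congr (_ / _).
  by rewrite -{1}[N](mulfK b0) -mulrDl -addrA [c + q]addrC.
by congr pair; exact: E.
Qed.

(** The truncations increase and the truncations plus one unit in the last place
    decrease, so the limit lies between them at every stage. *)
Lemma numeral_cvg (R : realType) (b : nat) (a : nat -> nat) :
  (forall i, a i < b)%N ->
  exists X : R, (numeral b a k)%:R / b%:R ^+ k @[k --> \oo] --> X /\
    forall k, (numeral b a k)%:R / b%:R ^+ k <= X <= ((numeral b a k)%:R + 1) / b%:R ^+ k.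
Proof.
move=> ab; have b0 : 0 < b%:R :> R by rewrite ltr0n (leq_ltn_trans _ (ab 0%N)).
pose q k : R := (numeral b a k)%:R / b%:R ^+ k.
pose r k : R := ((numeral b a k)%:R + 1) / b%:R ^+ k.
have qS k : q k <= q k.+1.
  rewrite /q /= natrD natrM exprSr invfM mulrA ler_pdivlMr// mulrAC.
  by rewrite ler_wpM2r ?invr_ge0 ?exprn_ge0 ?(ltW b0)// lerDl.
have rS k : r k.+1 <= r k.
  rewrite /r /= natrD natrM exprSr invfM mulrA ler_pdivrMr// [leRHS]mulrAC.
  rewrite ler_wpM2r ?invr_ge0 ?exprn_ge0 ?(ltW b0)//.
  by rewrite mulrDl mul1r -addrA lerD2l natr1 ler_nat.
have qr k : q k <= r k by rewrite ler_wpM2r ?invr_ge0 ?exprn_ge0 ?(ltW b0)// lerDl.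
have ndq : nondecreasing_seq q by apply/nondecreasing_seqP.
have nir : nonincreasing_seq r by apply/nonincreasing_seqP.
have qrk k l : q l <= r k.
  by rewrite (le_trans (ndq l (maxn k l) _)) ?leq_maxr// (le_trans (qr _))// nir ?leq_maxl.
have cq : cvgn q.
  by apply: nondecreasing_is_cvgn => //; exists (r 0%N) => _ [l _ <-].
exists (limn q); split => // k; apply/andP; split; first exact: nondecreasing_cvgn_le.
by apply: limr_le => //; apply: nearW => l; exact: qrk.
Qed.

Lemma coding_bounds (R : realType) (m n : nat) (x : nat -> digit m n) :
  let a i : nat := (x i).1 in let b i : nat := (x i).2 in
  forall k,
  (numeral m a k)%:R / m%:R ^+ k <= (coding R x).1
    <= ((numeral m a k)%:R + 1) / m%:R ^+ k /\
  (numeral n b k)%:R / n%:R ^+ k <= (coding R x).2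
    <= ((numeral n b k)%:R + 1) / n%:R ^+ k.
Proof.
move=> a b k.
have [X [cX bX]] := @numeral_cvg R m a (fun i => ltn_ord (x i).1).
have [Y [cY bY]] := @numeral_cvg R n b (fun i => ltn_ord (x i).2).
suff -> : coding R x = (X, Y) by split.
apply: cvg_lim; first exact: norm_hausdorff.
under eq_fun do rewrite foldr_S_map /= !addr0.
exact: (cvg_pair cX cY).
Qed.

(** Two points within b^-l of each other lie in b-adic intervals of level l whose
    indices differ by at most 2; the intervals are closed, so that a difference
    of 2 does occur, at common end points of a third one. *)
Lemma numeral_close (R : realFieldType) (b : nat) (p q : nat) (X Y : R) l :
  (0 < b)%N ->
  p%:R / b%:R ^+ l <= X <= (p%:R + 1) / b%:R ^+ l ->
  q%:R / b%:R ^+ l <= Y <= (q%:R + 1) / b%:R ^+ l ->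
  `|X - Y| <= (b%:R ^+ l)^-1 -> (q <= p + 2)%N.
Proof.
move=> b0; have B0 : 0 < b%:R ^+ l :> R by rewrite exprn_gt0// ltr0n.
rewrite !ler_pdivrMr// !ler_pdivlMr// => /andP[pX Xp] /andP[qY Yq].
rewrite -[_^-1]mul1r ler_pdivlMr// -(gtr0_norm B0) -normrM mulrBl.
rewrite ler_norml => /andP[XY YX].
by rewrite -(ler_nat R) natrD; lra.
Qed.

(** * Scales *)

Section levels.
Variables (R : realType) (b : nat).
Hypothesis b2 : (2 <= b)%N.

Lemma exists_expV_lt (e : R) : 0 < e -> exists k, (b%:R ^+ k)^-1 < e.
Proof.
move=> e0; exists (Num.bound e^-1).
have b0 : 0 < b%:R :> R by rewrite ltr0n (leq_trans _ b2).
rewrite invf_plt ?posrE ?exprn_gt0//.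
rewrite (lt_le_trans (archi_boundP _)) ?invr_ge0 ?(ltW e0)//.
by rewrite -natrX ler_nat ltnW// ltn_expl.
Qed.

Lemma exists_level (d : R) : 0 < d <= 1 ->
  exists l, (b%:R ^+ l.+1)^-1 < d <= (b%:R ^+ l)^-1.
Proof.
move=> /andP[d0 d1]; have [k0 k0P] := exists_expV_lt d0.
pose P k := (b%:R ^+ k)^-1 < d.
have exP : exists k, P k by exists k0.
case: (ex_minnP exP) => -[|l] Pl minl.
  by move: Pl; rewrite /P expr0 invr1 ltNge d1.
exists l; apply/andP; split => //; rewrite leNgt; apply/negP => /minl.
by rewrite ltnn.
Qed.

(** A set of diameter d is replaced by cylinders of length l with b^-l about d.
    The error term e is there for d = 0 < s: no l is then exact, but
    l can be taken so large that the weight b^(-s l) is at most e. *)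
Lemma diam_level (s d e : R) : 0 <= s -> 0 <= d <= 1 -> 0 < e ->
  exists l, d <= (b%:R ^+ l)^-1 /\
    (b%:R `^ (- s)) ^+ l <= b%:R `^ s * d `^ s + e.
Proof.
have b0 : 0 < b%:R :> R by rewrite ltr0n (leq_trans _ b2).
have b1 : 1 < b%:R :> R by rewrite ltr1n.
rewrite le_eqVlt => /predU1P[<-|s0] /andP[d0 d1] e0.
  exists 0%N; rewrite !expr0 invr1 !powRr0 mul1r; split => //.
  by rewrite lerDl ltW.
have tE l : (b%:R `^ (- s)) ^+ l = ((b%:R ^+ l)^-1) `^ s.
  rewrite -powR_mulrn ?powR_ge0// -powRrM -powR_mulrn ?(ltW b0)// -powRN -powRrM.
  by congr (_ `^ _); lra.
move: d0; rewrite le_eqVlt => /predU1P[<-|d0].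
  have [l le] := exists_expV_lt (powR_gt0 s^-1 e0).
  exists l; split; first by rewrite invr_ge0 exprn_ge0// ltW.
  rewrite powR0 ?gt_eqF// mulr0 add0r tE.
  have -> : e = (e `^ s^-1) `^ s by rewrite -powRrM mulVf ?gt_eqF// powRr1// ltW.
  by rewrite ge0_ler_powR// ?nnegrE ?invr_ge0 ?exprn_ge0 ?powR_ge0 ?(ltW b0)// ltW.
have [l /andP[ld dl]] := exists_level (introT andP (conj d0 d1)).
exists l; split => //.
apply: (@le_trans _ _ (b%:R `^ s * d `^ s)); last by rewrite lerDl ltW.
have -> : (b%:R `^ (- s)) ^+ l = b%:R `^ s * ((b%:R ^+ l.+1)^-1) `^ s.
  rewrite -tE exprS mulrA -powRD; last by rewrite (gt_eqF b0) implybT.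
  by rewrite addrN powRr0 mul1r.
rewrite ler_wpM2l ?powR_ge0// ge0_ler_powR//;
  by rewrite ?nnegrE ?invr_ge0 ?exprn_ge0 ?(ltW b0)// ltW.
Qed.
End levels.

Lemma sum_half (R : realFieldType) N : \sum_(i < N) (2^-1 : R) ^+ i.+1 <= 1.
Proof.
suff -> : \sum_(i < N) (2^-1 : R) ^+ i.+1 = 1 - 2^-1 ^+ N.
  by rewrite gerBl exprn_ge0// invr_ge0.
elim: N => [|N IHN]; first by rewrite big_ord0 expr0 subrr.
rewrite big_ord_recr/= IHN exprS; lra.
Qed.

(** * The lower bounds *)

Section diameter.
Variable R : realType.
Implicit Types (U : set (R * R)) (p q : R * R).

Lemma diam_ge0 U : (0 <= diam U)%E.
Proof. by rewrite /diam le_max lexx. Qed.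

Lemma edist_le_diam U p q r : (diam U <= r%:E)%E -> U p -> U q -> Defs.edist p q <= r.
Proof.
move=> Ur Up Uq; rewrite -lee_fin; apply: le_trans Ur.
rewrite /diam le_max; apply/orP; right; apply: ereal_sup_ubound.
by exists p => //; exists q.
Qed.

Lemma dist1_le_edist p q : `|p.1 - q.1| <= Defs.edist p q.
Proof. by rewrite -sqrtr_sqr ler_wsqrtr// lerDl sqr_ge0. Qed.

Lemma dist2_le_edist p q : `|p.2 - q.2| <= Defs.edist p q.
Proof. by rewrite -sqrtr_sqr ler_wsqrtr// lerDr sqr_ge0. Qed.

Lemma diam_pow_ge0 s U : (0 <= diam_pow s U)%E.
Proof. by rewrite /diam_pow; case: ifP => // _; exact: poweR_ge0. Qed.

End diameter.

(** The general lower bound by Furstenberg's argument.  The relation code links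
    sequences to points of E; the last hypothesis says that the points in a set
    of diameter at most b^-l come from at most #|T| words of length l.  A relation
    instead of a map is needed for projected sequences, which may each correspond
    to many points. *)
Lemma hausdorff_dim_ge (R : realType) (A : finType) (Gamma : set (nat -> A))
    (b : nat) (T : finType) (E : set (R * R))
    (code : (nat -> A) -> R * R -> Prop) :
  @Defs.shift A @` Gamma `<=` Gamma -> Gamma !=set0 -> cylinder_compact Gamma ->
  (2 <= b)%N ->
  (forall x, Gamma x -> exists2 z, E z & code x z) ->
  (forall U l, (diam U <= ((b%:R ^+ l)^-1)%:E)%E ->
    exists v : (nat -> A) -> T, forall x y z z', code x z -> code y z' ->
      U z -> U z' -> v x = v y -> mkseq x l = mkseq y l) ->
  ((entropy R Gamma / ln b%:R)%:E <= hausdorff_dim E)%E.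
Proof.
move=> sG G0 cG b2 codeE vU.
have b0 : 0 < b%:R :> R by rewrite ltr0n (leq_trans _ b2).
have lnb : 0 < ln b%:R :> R by rewrite ln_gt0// ltr1n.
apply: le_ereal_inf_tmp => _ [s [s0 Hs] <-]; rewrite lee_fin ler_pdivrMr//.
pose t : R := b%:R `^ (- s); have t0 : 0 < t by exact: powR_gt0.
suff [W [WG W0 W1]] : exists W : seq (seq A),
    [/\ forall x, Gamma x -> exists2 w, w \in W & mkseq x (size w) = w,
        forall w, w \in W -> (0 < size w)%N & \sum_(w <- W) t ^+ size w <= 1].
  have [K K0 aK] := furstenberg_bound sG t0 WG W0 W1.
  have := entropy_le sG G0 t0 K0 aK.
  by rewrite /t ln_powR mulNr opprK.
pose C : R := #|T|%:R; have C0 : 0 <= C by [].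
(* The cover is chosen so that the total weight of the cylinders, at most
   C times (e + e), is below 1; this also excludes the empty word, of weight 1. *)
pose e : R := (4 * (C + 1))^-1; have e0 : 0 < e by rewrite invr_gt0 mulr_gt0// ltr_wpDl.
have bs0 : 0 < b%:R `^ s :> R by exact: powR_gt0.
have [U [EU dU] sumU] : exists2 U : nat -> set (R * R),
    E `<=` \bigcup_i U i /\ (forall i, (diam (U i) <= 1%:E)%E) &
    (\sum_(0 <= i <oo) diam_pow s (U i) < (e / b%:R `^ s)%:E)%E.
  have : (hausdorff_pre s 1 E < (e / b%:R `^ s)%:E)%E.
    rewrite (@le_lt_trans _ _ 0%E) ?lte_fin ?divr_gt0// -Hs.
    by apply: ereal_sup_ubound; exists 1 => /=.
  by move=> /ereal_inf_lt[_ [U PU <-] sumU]; exists U.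
pose d i := fine (diam (U i)).
have dE i : diam (U i) = (d i)%:E.
  by rewrite /d fineK// ge0_fin_numE ?diam_ge0// (le_lt_trans (dU i)) ?ltry.
have d01 i : 0 <= d i <= 1.
  by rewrite -!lee_fin -dE diam_ge0 dU.
pose p i : R := if `[< U i = set0 >] then 0 else d i `^ s.
have pE i : diam_pow s (U i) = (p i)%:E.
  by rewrite /diam_pow /p; case: ifP => // _; rewrite dE.
have p0 i : 0 <= p i by rewrite -lee_fin -pE diam_pow_ge0.
have sump N : \sum_(i < N) p i <= e / b%:R `^ s.
  rewrite -lee_fin; apply: le_trans (ltW sumU).
  apply: le_trans (nneseries_lim_ge N _); last by move=> *; exact: diam_pow_ge0.
  by rewrite -sumEFin big_mkord; apply: lee_sum => i _; rewrite pE.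
have ei i : 0 < e * 2^-1 ^+ i.+1 :> R by rewrite mulr_gt0// exprn_gt0// invr_gt0.
have /choice[l lP] := fun i => @diam_level R b b2 s (d i) _ s0 (d01 i) (ei i).
have /choice[v vP] : forall i, exists v : (nat -> A) -> T, forall x y z z',
    code x z -> code y z' -> U i z -> U i z' -> v x = v y ->
    mkseq x (l i) = mkseq y (l i).
  by move=> i; apply: vU; rewrite dE lee_fin; case: (lP i).
(* One word for each value of v i that is attained on the codes of points of
   U i; in particular none when U i is empty, as its Hausdorff weight is 0. *)
pose coded i c := [set x | v i x = c /\ exists2 z, code x z & U i z].
have [x0 Gx0] := G0.
pose W i := [seq mkseq (xget x0 (coded i c)) (l i) |
  c <- enum T & `[< coded i c !=set0 >]].
have sizeW i w : w \in W i -> size w = l i.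
  by move=> /mapP[c _ ->]; rewrite size_mkseq.
have WC i : (size (W i))%:R <= C.
  rewrite size_map size_filter ler_nat (leq_trans (count_size _ _))//.
  by rewrite cardE.
pose c i := C * (b%:R `^ s * p i + e * 2^-1 ^+ i.+1).
have c0 i : 0 <= c i by rewrite mulr_ge0// addr_ge0 ?(ltW (ei i))// mulr_ge0// ltW.
have sumW i : (size (W i))%:R * t ^+ l i <= c i.
  have [W0|] := eqVneq (W i) [::]; first by rewrite W0 mul0r.
  move=> Wn0; have Un0 : U i <> set0.
    move=> U0; move: Wn0; rewrite /W.
    have -> : [seq c <- enum T | `[< coded i c !=set0 >]] = [::].
      apply/eqP; rewrite -size_eq0 size_filter eqn0Ngt -has_count; apply/hasPn => a _.
      by apply/asboolPn => -[x [_ [z _]]]; rewrite U0.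
    by rewrite eqxx.
  apply: ler_pM => //; first by rewrite exprn_ge0// ltW.
  by case: (lP i) => _; rewrite /p; case: asboolP.
have sumc N : \sum_(i < N) c i <= 2^-1.
  rewrite -mulr_sumr big_split/= -!mulr_sumr.
  apply: (@le_trans _ _ (C * (e + e))).
    rewrite ler_wpM2l// lerD//; last by rewrite ler_piMr ?sum_half// ltW.
    by rewrite mulrC -ler_pdivlMr; first exact: sump.
  have : (C + 1) * e = 4^-1.
    by rewrite /e invfM mulrCA mulfV ?mulr1// gt_eqF// ltr_wpDl.
  by rewrite mulrDl mul1r => Ce; rewrite mulrDr; lra.
have l0 i w : w \in W i -> (0 < l i)%N.
  move=> Ww; rewrite lt0n; apply/eqP => li0.
  have : (1 : R) <= 2^-1.
    apply: le_trans (sumc i.+1); rewrite big_ord_recr/=.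
    apply: (@le_trans _ _ (c i)); last by rewrite lerDr sumr_ge0.
    apply: le_trans (sumW i); rewrite li0 expr0 mulr1 ler1n.
    by case: (W i) Ww.
  lra.
have [|x Gx|N NP] := cG (fun i => [set x | exists2 w, w \in W i & mkseq x (size w) = w]).
- move=> i; exists (l i) => x y xy [w Ww xw]; exists w => //.
  rewrite -{2}xw; apply/eq_in_map => j; rewrite mem_iota add0n (sizeW _ _ Ww) => jl.
  by rewrite xy.
- have [z Ez xz] := codeE x Gx; have [i _ Uiz] := EU z Ez; exists i => //=.
  have cx : coded i (v i x) x by split => //; exists z.
  have [vy [z' yz' Uz']] := xgetPex x0 (ex_intro _ x cx).
  exists (mkseq (xget x0 (coded i (v i x))) (l i)).
    by apply: map_f; rewrite mem_filter mem_enum andbT; apply/asboolP; exists x.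
  by rewrite size_mkseq; apply: (vP i _ _ z z').
exists (flatten [seq W i | i <- iota 0 N]); split.
- move=> x Gx; have [i iN [w Ww xw]] := NP x Gx; exists w => //.
  by apply/flattenP; exists (W i) => //; apply: map_f; rewrite mem_iota.
- move=> w /flattenP[_ /mapP[i _ ->] Ww]; rewrite (sizeW i w Ww); exact: l0 Ww.
- apply: (@le_trans _ _ (\sum_(i < N) c i)); last by apply: (le_trans (sumc N)); lra.
  rewrite big_flatten/= big_map -[X in iota 0 X]subn0 -/(index_iota 0 N) big_mkord.
  apply: ler_sum => i _; apply: le_trans (sumW i).
  rewrite big_seq (eq_bigr (fun=> t ^+ l i)); last by move=> w /sizeW ->.
  by rewrite -big_seq big_const_seq count_predT iter_addr_0 mulr_natl.
Qed.

(** The label p + 2 - c of a number p within 2 of c is not truncated and takes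
    five values. *)
Lemma inord_window p q c : (p <= c + 2)%N -> (c <= p + 2)%N ->
  (q <= c + 2)%N -> (c <= q + 2)%N ->
  inord (p + 2 - c) = inord (q + 2 - c) :> 'I_5 -> p = q.
Proof.
move=> pc cp qc cq /(congr1 val) /=.
have small r : (r <= c + 2)%N -> (r + 2 - c < 5)%N.
  by move=> rc; rewrite ltnS leq_subLR (addnA c 2 2) leq_add2r.
rewrite !inordK ?small// => E; apply: (@addIn 2).
by rewrite -(subnK cp) E subnK.
Qed.

Section coding_windows.
Variables (R : realType) (m n : nat).
Implicit Types (x y : nat -> digit m n) (U : set (R * R)).
Let num1 x l := numeral m (fun i => (x i).1) l.
Let num2 x l := numeral n (fun i => (x i).2) l.

Lemma num1_close U l x y : (diam U <= ((m%:R ^+ l)^-1)%:E)%E ->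
  U (coding R x) -> U (coding R y) -> (num1 x l <= num1 y l + 2)%N.
Proof.
move=> Ul Ux Uy; have [bx _] := coding_bounds R x l; have [by_ _] := coding_bounds R y l.
apply: numeral_close by_ bx _; first by exact: leq_ltn_trans (ltn_ord (x 0%N).1).
exact: le_trans (dist1_le_edist _ _) (edist_le_diam Ul Uy Ux).
Qed.

Lemma num2_close U l x y : (diam U <= ((n%:R ^+ l)^-1)%:E)%E ->
  U (coding R x) -> U (coding R y) -> (num2 x l <= num2 y l + 2)%N.
Proof.
move=> Ul Ux Uy; have [_ bx] := coding_bounds R x l; have [_ by_] := coding_bounds R y l.
apply: numeral_close by_ bx _; first by exact: leq_ltn_trans (ltn_ord (x 0%N).2).
exact: le_trans (dist2_le_edist _ _) (edist_le_diam Ul Uy Ux).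
Qed.
End coding_windows.

Lemma shift_proj m n (Sigma : set (nat -> digit m n)) :
  @Defs.shift _ @` Sigma `<=` Sigma ->
  @Defs.shift _ @` (@proj_seq m n @` Sigma) `<=` @proj_seq m n @` Sigma.
Proof.
move=> sS _ [_ [x Sx <-] <-]; exists (Defs.shift x) => //; apply: sS; by exists x.
Qed.

Lemma hausdorff_dim_ge_proj (R : realType) m n (Sigma : set (nat -> digit m n)) :
  (2 <= m)%N -> Sigma !=set0 -> subshift Sigma ->
  ((entropy R (@proj_seq m n @` Sigma) / ln m%:R)%:E <=
    hausdorff_dim (@coding R m n @` Sigma))%E.
Proof.
move=> m2 [x0 Sx0] [cS sS].
apply: (@hausdorff_dim_ge R _ _ m 'I_5 _
  (fun g z => exists2 x, @proj_seq m n x = g & coding R x = z)) => //.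
- exact: shift_proj.
- by exists (proj_seq x0); exists x0.
- exact: (@cylinder_compact_image _ _ fst _ (compact_cylinder_compact cS)).
- by move=> _ [x Sx <-]; exists (coding R x); exists x.
- move=> U l Ul; have [[y Uy]|noU] := pselect (exists y : nat -> digit m n, U (coding R y)).
    exists (fun g : nat -> 'I_m => inord (numeral m (fun i => g i) l + 2
      - numeral m (fun i => (y i).1) l)).
    move=> _ _ _ _ [a <- <-] [b <- <-] Ua Ub E; apply/eq_mkseqP => i il.
    apply/val_inj; move: i il; apply: (@numeral_inj m) => [i|i|]; try exact: ltn_ord.
    by apply: inord_window E; [exact: (num1_close Ul Ua Uy)|exact: (num1_close Ul Uy Ua)
      |exact: (num1_close Ul Ub Uy)|exact: (num1_close Ul Uy Ub)].
  by exists (fun=> ord0) => g g' z z' [a _ <-] _ Ua; exfalso; apply: noU; exists a.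
Qed.

(** Sets of diameter at most n^-l also have diameter at most m^-l, so both
    coordinates of the code are controlled up to level l. *)
Lemma hausdorff_dim_ge_full (R : realType) m n (Sigma : set (nat -> digit m n)) :
  (0 < m)%N -> (m <= n)%N -> (2 <= n)%N -> Sigma !=set0 -> subshift Sigma ->
  ((entropy R Sigma / ln n%:R)%:E <= hausdorff_dim (@coding R m n @` Sigma))%E.
Proof.
move=> m0 mn n2 S0 [cS sS].
apply: (@hausdorff_dim_ge R _ _ n ('I_5 * 'I_5)%type _ (fun x z => coding R x = z)) => //.
- exact: compact_cylinder_compact.
- by move=> x Sx; exists (coding R x) => //; exists x.
- move=> U l Un.
  have Um : (diam U <= ((m%:R ^+ l)^-1)%:E)%E.
    apply: le_trans Un _; rewrite lee_fin lef_pV2 ?posrE ?exprn_gt0 ?ltr0n ?(ltnW n2)//.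
    by rewrite lerXn2r ?nnegrE// ler_nat.
  have [[y Uy]|noU] := pselect (exists y : nat -> digit m n, U (coding R y)).
    pose v (x : nat -> digit m n) : 'I_5 * 'I_5 :=
      (inord (numeral m (fun i => (x i).1) l + 2 - numeral m (fun i => (y i).1) l),
       inord (numeral n (fun i => (x i).2) l + 2 - numeral n (fun i => (y i).2) l)).
    exists v => a b _ _ <- <- Ua Ub [E1 E2]; apply/eq_mkseqP => i il.
    rewrite (surjective_pairing (a i)) (surjective_pairing (b i)); congr pair; apply/val_inj.
      move: i il; apply: (@numeral_inj m) => [i|i|]; try exact: ltn_ord.
      by apply: inord_window E1; [exact: (num1_close Um Ua Uy)|exact: (num1_close Um Uy Ua)
        |exact: (num1_close Um Ub Uy)|exact: (num1_close Um Uy Ub)].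
    move: i il; apply: (@numeral_inj n) => [i|i|]; try exact: ltn_ord.
    by apply: inord_window E2; [exact: (num2_close Un Ua Uy)|exact: (num2_close Un Uy Ua)
      |exact: (num2_close Un Ub Uy)|exact: (num2_close Un Uy Ub)].
  by exists (fun=> (ord0, ord0)) => a b z z' <- _ Ua; exfalso; apply: noU; exists a.
Qed.

(** * Hausdorff dimension and box dimensions *)

Lemma limf_einf_lt (R : realType) (X : choiceType) (T : filteredType X)
    (f : T -> \bar R) (F : set_system T)
    (V : set T) c :
  F V -> (limf_einf f F < c)%E -> exists2 x, V x & (f x < c)%E.
Proof.
rewrite limf_einfE => FV fc.
have : (ereal_inf (f @` V) < c)%E.
  by apply: le_lt_trans fc; apply: ereal_sup_ubound; exists V.
by move=> /ereal_inf_lt[_ [x Vx <-] xc]; exists x.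
Qed.

Lemma limf_esup_le (R : realType) (X : choiceType) (T : filteredType X)
    (f : T -> \bar R) (F : set_system T)
    (V : set T) c :
  F V -> (forall x, V x -> (f x <= c)%E) -> (limf_esup f F <= c)%E.
Proof.
rewrite limf_esupE => FV fc.
apply: (@le_trans _ _ (ereal_sup (f @` V))).
  by apply: ereal_inf_lbound; exists V.
by apply: ge_ereal_sup => _ [x Vx <-]; exact: fc.
Qed.

Lemma limf_einf_le_esup (R : realType) (X : choiceType) (T : filteredType X)
    (f : T -> \bar R) (F : set_system T) : ProperFilter F -> (limf_einf f F <= limf_esup f F)%E.
Proof.
move=> PF; rewrite limf_einfE limf_esupE.
apply: ge_ereal_sup => _ [V FV <-]; apply: le_ereal_inf_tmp => _ [W FW <-].
have [x [Vx Wx]] := filter_ex (filterI FV FW).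
apply: (@le_trans _ _ (f x)).
  by apply: ereal_inf_lbound; exists x.
by apply: ereal_sup_ubound; exists x.
Qed.

Lemma hausdorff_pre_ge0 (R : realType) (s delta : R) (E : set (R * R)) :
  (0 <= hausdorff_pre s delta E)%E.
Proof.
apply: le_ereal_inf_tmp => _ [U _ <-]; apply: nneseries_ge0 => i _ _.
exact: diam_pow_ge0.
Qed.

Lemma hausdorff_pre_le_covering (R : realType) (s delta delta0 : R) (E : set (R * R))
    (k : nat) (U : 'I_k -> set (R * R)) :
  0 < delta <= delta0 -> E `<=` \bigcup_i U i ->
  (forall i, diam (U i) = delta%:E) ->
  (hausdorff_pre s delta0 E <= (k%:R * delta `^ s)%:E)%E.
Proof.
move=> /andP[d0 dd0] EU dU.
pose V (i : nat) := if insub i is Some j then U j else set0.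
apply: (@le_trans _ _ (\sum_(0 <= i <oo) diam_pow s (V i))%E).
  apply: ereal_inf_lbound; exists V => //; split.
    move=> z /EU[i _ Uz]; exists (val i) => //; rewrite /V valK//.
  move=> i; rewrite /V; case: insubP => [j _ _|_]; first by rewrite dU lee_fin.
  rewrite /diam ge_max lee_fin ltW ?(lt_le_trans d0)//=.
  by apply: ge_ereal_sup => _ [p []].
rewrite (nneseries_split 0 k); last by move=> *; exact: diam_pow_ge0.
rewrite eseries0 ?adde0; last first.
  move=> i; rewrite add0n => ki _; rewrite /V insubN -?leqNgt//.
  by rewrite /diam_pow; case: asboolP.
rewrite add0n big_mkord; apply: (@le_trans _ _ (\sum_(i < k) (delta `^ s)%:E)%E).
  apply: lee_sum => i _; rewrite /V valK /diam_pow dU.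
  by case: asboolP => // _; rewrite lee_fin powR_ge0.
by rewrite sumEFin big_const_ord iter_addr_0 mulr_natl.
Qed.

Lemma covering_number_ge0 (R : realType) (delta : R) (E : set (R * R)) :
  (0 <= covering_number delta E)%E.
Proof. by apply: le_ereal_inf_tmp => _ [k _ <-]; rewrite lee_fin. Qed.

Lemma box_ratio_lt_cover (R : realType) (E : set (R * R)) (delta c : R) :
  0 < delta < 1 -> (box_ratio E delta < c%:E)%E ->
  exists k (U : 'I_k -> set (R * R)),
    [/\ k%:R < delta `^ (- c), E `<=` \bigcup_i U i & forall i, diam (U i) = delta%:E].
Proof.
move=> /andP[d0 d1]; have T0 : 0 < - ln delta by rewrite oppr_gt0 ln_lt0// d0.
rewrite /box_ratio inver gt_eqF// lte_pdivrMr// -EFinM -lte_expeR.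
have /eqP -> := etrans (lneK_eq (covering_number delta E)) (covering_number_ge0 delta E).
move=> /= /ereal_inf_lt[_ [k [U [EU dU]] <-]]; rewrite lte_fin => kc.
exists k, U; split => //; rewrite /powR gt_eqF// mulNr -mulrN; exact: kc.
Qed.

(** Since the lower box dimension is below c, arbitrarily small delta admit covers
    by fewer than delta^-c sets of diameter delta.  Such a cover is not empty,
    which forces c to be positive. *)
Lemma hausdorff_measure0 (R : realType) (E : set (R * R)) (c s : R) :
  E !=set0 -> (lower_box_dim E < c%:E)%E -> c < s ->
  0 < c /\ hausdorff_measure s E = 0%E.
Proof.
move=> [z Ez] Ec cs.
have small r : 0 < r -> exists k (U : 'I_k -> set (R * R)) delta,
    [/\ 0 < delta < r, delta < 1, k%:R < delta `^ (- c),
     E `<=` \bigcup_i U i & forall i, diam (U i) = delta%:E].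
  move=> r0; pose V := [set delta : R | 0 < delta < r /\ delta < 1].
  have FV : (0 : R)^'+ V.
    near=> d; split; first (apply/andP; split).
    - by near: d; exact: nbhs_right_gt.
    - by near: d; exact: nbhs_right_lt.
    - by near: d; exact: nbhs_right_lt.
  have [d [/andP[d0 dr] d1] dc] := limf_einf_lt FV Ec.
  have [|k [U [kU EU dU]]] := box_ratio_lt_cover _ dc; first by rewrite d0.
  by exists k, U, d; split => //; rewrite d0.
split.
  have [k [U [d [/andP[d0 _] d1 kU EU dU]]]] := small 1 ltr01.
  have k1 : 1 <= k%:R :> R.
    by rewrite ler1n; have [i _ _] := EU z Ez; exact: leq_ltn_trans (ltn_ord i).
  have := le_lt_trans k1 kU; rewrite /powR gt_eqF// expR_gt1 mulNr -mulrN.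
  by rewrite pmulr_lgt0// oppr_gt0 ln_lt0// d0.
apply/eqP; rewrite eq_le; apply/andP; split; last first.
  apply: (@le_trans _ _ (hausdorff_pre s 1 E)); first exact: hausdorff_pre_ge0.
  by apply: ereal_sup_ubound; exists 1 => /=.
apply: ge_ereal_sup => _ [d0 /= d00 <-].
apply/lee_addgt0Pr => e e0; rewrite add0e.
have sc : 0 < s - c by rewrite subr_gt0.
have [|k [U [d [/andP[dgt0 dlt] d1 kU EU dU]]]] := small (Num.min d0 (e `^ (s - c)^-1)).
  by rewrite lt_min d00 powR_gt0.
move: dlt; rewrite lt_min => /andP[dd0 de].
apply: (@le_trans _ _ (k%:R * d `^ s)%:E).
  by apply: (hausdorff_pre_le_covering s _ EU dU); rewrite dgt0 ltW.
rewrite lee_fin (@le_trans _ _ (d `^ (- c) * d `^ s))//.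
  by rewrite ler_wpM2r ?powR_ge0// ltW.
rewrite -powRD; last by rewrite (gt_eqF dgt0) implybT.
have -> : e = (e `^ (s - c)^-1) `^ (s - c).
  by rewrite -powRrM mulVf ?gt_eqF// powRr1// ltW.
by rewrite addrC ge0_ler_powR ?nnegrE ?powR_ge0// ?ltW.
Unshelve. all: by end_near. Qed.

Lemma hausdorff_dim_le_lower_box (R : realType) (E : set (R * R)) :
  E !=set0 -> (hausdorff_dim E <= lower_box_dim E)%E.
Proof.
move=> E0.
have H c s : (lower_box_dim E < c%:E)%E -> c < s -> (hausdorff_dim E <= s%:E)%E.
  move=> Ec cs; have [c0 Hs] := hausdorff_measure0 E0 Ec cs.
  by apply: ereal_inf_lbound; exists s => //; split => //; rewrite ltW// (lt_trans c0).
case: (lower_box_dim E) H (hausdorff_measure0 E0 (c := 0) (s := 1)) => [l| |] H.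
- move=> _; apply/lee_addgt0Pr => e e0; rewrite -EFinD.
  by apply: (H (l + e / 2)); rewrite ?lte_fin; lra.
- by rewrite leey.
- by move=> /(_ (ltNyr 0) ltr01)[]; rewrite ltxx.
Qed.

(** * The upper bound *)

(** Closed squares serve as covering sets because their diameter is known
    exactly, as the covering number requires. *)
Definition square (R : realType) (p : R * R) (c : R) : set (R * R) :=
  [set z | p.1 <= z.1 <= p.1 + c /\ p.2 <= z.2 <= p.2 + c].

Lemma diam_square (R : realType) (p : R * R) (c : R) : 0 <= c ->
  diam (square p c) = (Num.sqrt 2 * c)%:E.
Proof.
move=> c0.
have cE : Num.sqrt 2 * c = Num.sqrt (c ^+ 2 + c ^+ 2).
  have -> : c ^+ 2 + c ^+ 2 = 2 * c ^+ 2 by lra.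
  by rewrite sqrtrM// sqrtr_sqr ger0_norm.
apply/eqP; rewrite eq_le; apply/andP; split.
  rewrite /diam ge_max lee_fin mulr_ge0 ?sqrtr_ge0//=.
  apply: ge_ereal_sup => _ [x [x1 x2] [y [y1 y2] <-]].
  rewrite lee_fin cE; apply: ler_wsqrtr; apply: lerD.
    rewrite -(@real_normK _ (x.1 - y.1)) ?num_real// lerXn2r ?nnegrE//.
    by rewrite ler_norml; lra.
  rewrite -(@real_normK _ (x.2 - y.2)) ?num_real// lerXn2r ?nnegrE//.
  by rewrite ler_norml; lra.
rewrite /diam le_max; apply/orP; right; apply: ereal_sup_ubound.
exists (p.1 + c, p.2 + c); first by split => /=; lra.
exists p; first by split; lra.
by rewrite /Defs.edist /= cE; congr (Num.sqrt (_ ^+ _ + _ ^+ _))%:E; lra.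
Qed.

(** Approximate squares: the first l letters and the next L - l projected letters
    determine L digits of the first coordinate and l digits of the second, hence
    the lower left corner of a square that contains the coded point.  The side
    delta / sqrt 2 makes the diameter equal to delta. *)
Lemma covering_number_coding_le (R : realType) m n (Sigma : set (nat -> digit m n))
    (delta : R) (l L : nat) :
  Sigma !=set0 -> @Defs.shift _ @` Sigma `<=` Sigma ->
  0 < delta -> (l <= L)%N -> (n ^ l <= m ^ L)%N ->
  (n%:R ^+ l)^-1 <= delta / Num.sqrt 2 ->
  (covering_number delta (@coding R m n @` Sigma) <=
    (#|words Sigma l| * #|words (@proj_seq m n @` Sigma) (L - l)|)%N%:R%:E)%E.
Proof.
move=> [x0 Sx0] sS d0 lL nm nc; set c := delta / _ in nc.
have s20 : 0 < Num.sqrt 2 :> R by rewrite sqrtr_gt0.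
have c0 : 0 < c by rewrite divr_gt0.
have n0 : (0 < n)%N by exact: leq_ltn_trans (ltn_ord (x0 0%N).2).
have m0 : (0 < m)%N by exact: leq_ltn_trans (ltn_ord (x0 0%N).1).
have mc : (m%:R ^+ L)^-1 <= c.
  apply: le_trans nc; rewrite lef_pV2 ?posrE ?exprn_gt0 ?ltr0n//.
  by rewrite -!natrX ler_nat.
set A := words _ _; set B := words _ _.
pose code (x : nat -> digit m n) :=
  (initial_word x l, initial_word (fun i => (x (l + i)%N).1) (L - l)).
have codeS x : Sigma x -> code x \in finset.setX A B.
  move=> Sx; rewrite finset.in_setX; apply/andP; split; first exact: mem_words.
  apply: (@mem_words _ _ (shift_proj sS) (fun i => (x (l + i)%N).1)).
  by exists (fun i => x (l + i)%N) => //; exact: (shift_iter sS l Sx).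
pose num1 (x : nat -> digit m n) := numeral m (fun i => (x i).1) L.
pose num2 (x : nat -> digit m n) := numeral n (fun i => (x i).2) l.
have codeE x y : code x = code y -> num1 x = num1 y /\ num2 x = num2 y.
  move=> [/eq_mkseqP E1 /eq_mkseqP E2]; split; apply: eq_numeral => i iL; last by rewrite E1.
  have [il|li] := ltnP i l; first by rewrite E1.
  by rewrite -(subnKC li) E2// ltn_sub2r// (leq_ltn_trans li).
(* The corner attached to a pair of words is read off from any sequence with
   these words; x0 is a dummy for the pairs that do not occur. *)
pose pick w := xget x0 [set x | Sigma x /\ code x = w].
pose corner x : R * R := ((num1 x)%:R / m%:R ^+ L, (num2 x)%:R / n%:R ^+ l).
apply: ereal_inf_lbound; exists (#|A| * #|B|)%N => //; rewrite -cardsX.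
exists (fun i => square (corner (pick (enum_val i))) c); split; last first.
  by move=> i; rewrite diam_square ?ltW// /c mulrC divfK// gt_eqF.
move=> _ [x Sx <-]; have Sc := codeS x Sx.
exists (enum_rank_in Sc (code x)) => //=; rewrite enum_rankK_in//.
have [_ cy] := xgetPex x0
  (ex_intro (fun y => Sigma y /\ code y = code x) x (conj Sx erefl)).
have [E1 E2] := codeE _ _ cy.
rewrite /square /= /pick E1 E2.
have [+ _] := coding_bounds R x L; have [_ +] := coding_bounds R x l.
rewrite !mulrDl !mul1r => /andP[y1 y2] /andP[x1 x2]; split.
  by rewrite x1 (le_trans x2)// lerD2l.
by rewrite y1 (le_trans y2)// lerD2l.
Qed.

Lemma up_log_approx m n l : (2 <= m)%N -> (m <= n)%N -> (0 < l)%N ->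
  let L := up_log m (n ^ l) in
  [/\ (l <= L)%N, (n ^ l <= m ^ L)%N & (m ^ L <= m * n ^ l)%N].
Proof.
move=> m2 mn l0 L.
have n2 : (1 < n)%N by exact: leq_trans mn.
have nl : (1 < n ^ l)%N by rewrite -(exp1n l) ltn_exp2r.
have := up_log_bounds m2 nl; rewrite -/L => /andP[lo hi]; split => //.
  by rewrite -(leq_exp2l _ _ m2) (leq_trans _ hi)// leq_exp2r.
have L0 : (0 < L)%N by rewrite up_log_gt0 m2.
by rewrite -(prednK L0) expnS leq_mul2l (ltnW lo) orbT.
Qed.

Section upper_bound.
Variables (R : realType) (m n : nat) (Sigma : set (nat -> digit m n)).
Hypotheses (m2 : (2 <= m)%N) (mn : (m < n)%N).
Hypotheses (S0 : Sigma !=set0) (sS : @Defs.shift _ @` Sigma `<=` Sigma).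
Let E : set (R * R) := @coding R m n @` Sigma.
Let h : R := entropy R Sigma.
Let hpi : R := entropy R (@proj_seq m n @` Sigma).

(** With l and L as in [up_log_approx], the logarithm of the covering number is at
    most about l h + (L - l) hpi, where L - l is at most l (ln n / ln m - 1) + 1
    and l ln n is at most - ln delta up to a constant. *)
Lemma ln_covering_le e : 0 < e -> exists2 C : R, 0 <= C &
  forall delta, 0 < delta < 1 ->
  (lne (covering_number delta E) <=
   ((hpi / ln m%:R + (h - hpi) / ln n%:R + e) * (- ln delta) + C)%:E)%E.
Proof.
move=> e0.
have n2 : (2 <= n)%N by exact: leq_trans (ltnW mn).
set lm : R := ln m%:R; set ln_ : R := ln n%:R.
have lm0 : 0 < lm by rewrite ln_gt0// ltr1n.
have lmn : lm < ln_ by rewrite ltr_ln ?posrE ?ltr0n ?ltr_nat// ltnW.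
have ln0 : 0 < ln_ by exact: lt_trans lmn.
have P0 : @proj_seq m n @` Sigma !=set0.
  by have [x Sx] := S0; exists (proj_seq x); exists x.
(* The slack e' in both entropies raises the slope B by exactly e. *)
pose e' := e * lm; have e'0 : 0 < e' by exact: mulr_gt0.
have [h0 _ /(_ _ e'0)[C1 C10 HC1]] := entropyP R sS S0.
have [hpi0 _ /(_ _ e'0)[C2 C20 HC2]] := entropyP R (shift_proj sS) P0.
rewrite -/h in h0 HC1; rewrite -/hpi in hpi0 HC2.
pose B := hpi / lm + (h - hpi) / ln_ + e.
pose r := ln_ / lm; have lmr : lm * r = ln_ by rewrite mulrC divfK// gt_eqF.
have BE : B * ln_ = (h + e') + (hpi + e') * (r - 1).
  rewrite /B !mulrDl !divfK ?gt_eqF// -[hpi / lm * _]mulrA [lm^-1 * _]mulrC -/r.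
  have := congr1 ( *%R e) lmr; rewrite /e' => elmr; lra.
have he : 0 <= h + e' by rewrite addr_ge0// ltW.
have hpie : 0 <= hpi + e' by rewrite addr_ge0// ltW.
have B0 : 0 <= B.
  have r1 : 0 <= r - 1 by rewrite subr_ge0 ler_pdivlMr// mul1r ltW.
  by rewrite -(pmulr_lge0 _ ln0) BE addr_ge0// mulr_ge0.
pose s2 : R := ln (Num.sqrt 2).
have s20 : 0 < Num.sqrt 2 :> R by rewrite sqrtr_gt0.
have s21 : 1 <= Num.sqrt 2 :> R by rewrite -[X in X <= _]sqrtr1 ler_wsqrtr// ler1n.
exists (B * (s2 + ln_) + (hpi + e') + C1 + C2).
  have s2l : 0 <= s2 + ln_ by rewrite addr_ge0 ?(ltW ln0)//; exact: ln_ge0.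
  by rewrite addr_ge0// addr_ge0// addr_ge0// mulr_ge0.
move=> delta /andP[d0 d1].
have c01 : 0 < delta / Num.sqrt 2 <= 1.
  by rewrite divr_gt0//= ler_pdivrMr// mul1r (le_trans (ltW d1)).
have [l /andP[lc cl]] := exists_level n2 c01.
have [lL nL Ln] := up_log_approx m2 (ltnW mn) (ltn0Sn l).
set L := up_log _ _ in lL nL Ln.
have := covering_number_coding_le S0 sS d0 lL nL (ltW lc); rewrite -/E.
set a := #|_|; set b := #|_| => Nab.
have a0 : (0 < a)%N by exact: words_gt0.
have b0 : (0 < b)%N by apply: words_gt0 => //; exact: shift_proj.
apply: (@le_trans _ _ (lne (a * b)%N%:R%:E)).
  rewrite lee_lne// in_itv/= ?leey ?andbT ?covering_number_ge0//.
rewrite natrM lne_EFin ?mulr_gt0 ?ltr0n// lnM ?posrE ?ltr0n// lee_fin.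
have := HC1 l.+1; rewrite -/a => Ha.
have := HC2 (L - l.+1)%N; rewrite -/b natrB// => Hb.
have HL : L%:R - l.+1%:R <= 1 + l.+1%:R * (r - 1).
  have : L%:R * lm <= lm + l.+1%:R * ln_.
    have : ln (m ^ L)%N%:R <= ln (m * n ^ l.+1)%N%:R :> R.
      by rewrite ler_ln ?posrE ?ltr0n ?muln_gt0 ?expn_gt0 ?(ltnW m2) ?(ltnW n2)// ler_nat.
    rewrite natrM !natrX lnM ?posrE ?exprn_gt0 ?ltr0n ?(ltnW m2) ?(ltnW n2)//.
    by rewrite !lnXn ?ltr0n ?(ltnW m2) ?(ltnW n2)// -[_ *+ L]mulr_natl -[_ *+ l.+1]mulr_natl.
  rewrite -ler_pdivlMr// mulrDl divff ?gt_eqF// -mulrA -/r => HL.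
  by rewrite mulrBr mulr1; lra.
have Hl : l.+1%:R * ln_ <= - ln delta + (s2 + ln_).
  have : l%:R * ln_ <= - ln delta + s2.
    have := cl; rewrite -ler_ln ?posrE ?divr_gt0 ?invr_gt0 ?exprn_gt0 ?ltr0n ?(ltnW n2)//.
    rewrite ln_div ?posrE// lnV ?posrE ?exprn_gt0 ?ltr0n ?(ltnW n2)//.
    by rewrite lnXn ?ltr0n ?(ltnW n2)// -[_ *+ l]mulr_natl -/s2 -/ln_; lra.
  by rewrite -natr1 mulrDl mul1r; lra.
rewrite -/B.
apply: (@le_trans _ _ (l.+1%:R * ln_ * B + (hpi + e') + C1 + C2)); last first.
  have := ler_wpM2r B0 Hl; move: (l.+1%:R * ln_) => X.
  by rewrite mulrDl [_ * B]mulrC [(_ + _) * B]mulrC; lra.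
have -> : l.+1%:R * ln_ * B = l.+1%:R * (h + e') + (hpi + e') * (l.+1%:R * (r - 1)).
  by rewrite -mulrA [ln_ * B]mulrC BE mulrDr [X in _ + X]mulrCA.
have := ler_wpM2l hpie HL; rewrite [X in _ <= X -> _]mulrDr mulr1 [l.+1%:R * (h + _)]mulrC.
lra.
Qed.

Lemma upper_box_dim_le :
  (upper_box_dim E <= (hpi / ln m%:R + (h - hpi) / ln n%:R)%:E)%E.
Proof.
set B := _ / _ + _; apply/lee_addgt0Pr => e e0; rewrite -EFinD.
have [|C C0 HC] := @ln_covering_le (e / 2); first by rewrite divr_gt0.
pose V := [set delta : R | [/\ 0 < delta, delta < 1 & delta < expR (- (2 * C / e))]].
apply: (@limf_esup_le _ _ _ _ _ V).
  near=> d; split; near: d; [exact: nbhs_right_gt|exact: nbhs_right_lt|].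
  by apply: nbhs_right_lt; exact: expR_gt0.
move=> d [d0 d1 dC]; have T0 : 0 < - ln d by rewrite oppr_gt0 ln_lt0// d0.
rewrite /box_ratio inver gt_eqF// lee_pdivrMr// -EFinM.
apply: le_trans (HC d _) _; first by rewrite d0.
rewrite -/B lee_fin.
have : 2 * C / e <= - ln d.
  move: dC; rewrite -ltr_ln ?posrE ?expR_gt0// expRK; lra.
rewrite ler_pdivrMr// => TC.
have : C <= e / 2 * (- ln d) by lra.
rewrite !mulrDl; lra.
Unshelve. all: by end_near. Qed.

End upper_bound.

Theorem proposition2p1 (R : realType) (m n : nat) (hm : (2 <= m)%N)
  (hmn : (m < n)%N) (Sigma : set (nat -> digit m n))
  (hSigma0 : Sigma !=set0) (hSigma : subshift Sigma) :
  let h : R := entropy R Sigma in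
  let hpi : R := entropy R (@proj_seq m n @` Sigma) in
  let E : set (R * R) := @coding R m n @` Sigma in
  [/\ ((Num.max (hpi / ln m%:R) (h / ln n%:R))%:E <= hausdorff_dim E)%E,
      (hausdorff_dim E <= lower_box_dim E)%E,
      (lower_box_dim E <= upper_box_dim E)%E &
      (upper_box_dim E <= (hpi / ln m%:R + (h - hpi) / ln n%:R)%:E)%E].
Proof.
move=> h hpi E.
have E0 : E !=set0 by have [x Sx] := hSigma0; exists (coding R x); exists x.
split.
- rewrite EFin_max ge_max hausdorff_dim_ge_proj//=.
  by apply: hausdorff_dim_ge_full => //; [exact: ltnW|exact: ltnW|exact: leq_trans (ltnW hmn)].
- exact: hausdorff_dim_le_lower_box.
- exact: limf_einf_le_esup.
- by apply: upper_box_dim_le => //; case: hSigma.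
Qed.
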